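(* Let $\mathbb F$ be any field, let $n,k$ be positive integers with $n \ge k+2$, and let $\mathcal K \subseteq M_{n\times k}(\mathbb F)$ be a linear variety. Then the following are equivalent: (1) $\det_{n,k}(X)=0$ for all $X\in\mathcal K$ and $\operatorname{codim}(\mathcal K)=k$; (2) $k$ is odd and $\mathcal K$ is the vector space of all $X\in M_{n\times k}(\mathbb F)$ whose alternating row sum vanishes, i.e. $\sum_{i=1}^n (-1)^i X[i|) = 0$, where $X[i|)$ denotes the $i$-th row of $X$.
   Context: A linear variety in a finite-dimensional space $W$ is a nonempty set of the form $\mathcal K=\mathbf s+V=\{\mathbf s+\mathbf v:\mathbf v\in V\}$ with $V\subseteq W$ a linear subspace (uniquely determined by $\mathcal K$); $\dim\mathcal K=\dim V$ and $\operatorname{codim}\mathcal K=\dim W-\dim V$. Here $W=M_{n\times k}(\mathbb F)$, of dimension $nk$. Cullis' determinant: for $n\ge k$ and $X\in M_{n\times k}(\mathbb F)$, $\det_{n,k}(X)=\sum_{c}\operatorname{sgn}(c)\det\big(X[c|)\big)$, where $c$ ranges over the $k$-element subsets of $[n]=\{1,\dots,n\}$, $X[c|)$ is the $k\times k$ submatrix of $X$ formed by the rows with indices in $c$ (in increasing order), and, writing $c=\{c(1)<\dots<c(k)\}$, $\operatorname{sgn}(c)=(-1)^{\sum_{\alpha=1}^k (c(\alpha)-\alpha)}$. For $n=k$ it is the ordinary determinant. *)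

(* Defs.v *)
From HB Require Import structures.
From mathcomp Require Import all_boot all_order all_algebra.
Set Implicit Arguments. Unset Strict Implicit. Unset Printing Implicit Defensive.
Import GRing.Theory.
Local Open Scope ring_scope.

(* Cullis' determinant of X : 'M_(n,k).  The k-subsets c = {c(1)<...<c(k)} of
   [n] are encoded by strictly increasing maps f : 'I_k -> 'I_n (0-based, so
   c(alpha) - alpha = f alpha - alpha); X[c|) is \matrix_(i,j) X (f i) j. *)
Definition cullis_det (F : comNzRingType) (n k : nat) (X : 'M[F]_(n, k)) : F :=
  \sum_(f : {ffun 'I_k -> 'I_n} |
          [forall i : 'I_k, forall j : 'I_k, (i < j)%N ==> (f i < f j)%N])
    (-1) ^+ (\sum_(a < k) (f a - a))%N * \det (\matrix_(i < k, j < k) X (f i) j).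

(* Alternating row sum  sum_{i=1}^n (-1)^i X[i|)  (row i is 1-based in the paper). *)
Definition alt_row_sum (F : comNzRingType) (n k : nat) (X : 'M[F]_(n, k)) : 'rV[F]_k :=
  \sum_(i < n) (-1) ^+ i.+1 *: row i X.

Definition linvar (F : fieldType) (n k : nat) (s : 'M[F]_(n, k))
  (V : {vspace 'M[F]_(n, k)}) : pred 'M[F]_(n, k) :=
  [pred X | X - s \in V].

Definition linvar_codim (F : fieldType) (n k : nat) (V : {vspace 'M[F]_(n, k)}) : nat :=
  (n * k - \dim V)%N.

(* Main.v *)
Require Import Defs.
From HB Require Import structures.
From mathcomp Require Import all_boot all_order all_algebra.
From mathcomp Require Import perm ring zify.
Set Implicit Arguments. Unset Strict Implicit. Unset Printing Implicit Defensive.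
Import GRing.Theory.
Local Open Scope ring_scope.

(** After the sign change [X i j |-> (-1)^i X i j], Cullis' determinant becomes,
    up to a global sign, the sum of all maximal minors of [X]: an alternating
    [k]-form [w] in the columns of [X].

    If a nonzero alternating [k]-form vanishes on [s + V], then [codim V >= k]:
    when the matrix with first column [u] and zeros elsewhere lies in [V], the
    contraction of [w] by [u] vanishes on the projection of [s + V] to the other
    columns, and one inducts unless all such [u] lie in the radical of [w], whose
    codimension is at least [k].

    Let now [codim V = k] and let [w] be the sum of minors.  For [k >= 2] its
    radical has dimension at most one, so the same argument shows that for every
    row vector [v] the space of columns [u] with [u v] in [V] has codimension at
    most one.  A linear family of maps of rank one has a common kernel or a common
    image line, hence [V] contains all [X] with [phi X = 0] for some functional
    [phi <> 0].  Vanishing of [w] on [s + V] then gives [phi s = 0] and that [phi]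
    divides [w], and since [n >= k + 2], all entries of [phi] are equal.  Finally,
    the column-sum functional divides [w] exactly when [k] is odd. *)

(** * Strictly increasing maps as an encoding of row sets *)

Section IncreasingMaps.
Variables k n : nat.
Implicit Types f : {ffun 'I_k -> 'I_n}.

Definition increasing f :=
  [forall i : 'I_k, forall j : 'I_k, (i < j)%N ==> (f i < f j)%N].

Lemma increasingP f :
  reflect (forall i j : 'I_k, (i < j)%N -> (f i < f j)%N) (increasing f).
Proof.
apply: (iffP forallP) => [fP i j ltij | fP i].
  by move/forallP: (fP i) => /(_ j)/implyP; apply.
by apply/forallP=> j; apply/implyP; apply: fP.
Qed.

Lemma increasing_inj f : increasing f -> injective f.
Proof.
move=> /increasingP fP i j eqf; apply: val_inj => /=.
by case: (ltngtP i j) => // /fP; rewrite eqf ltnn.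
Qed.

Lemma increasing_gap f (i j : 'I_k) :
  increasing f -> (i <= j)%N -> (f i + (j - i) <= f j)%N.
Proof.
move=> /increasingP fP; case: j => j jk /=.
elim: j jk => [|j IHj] jk; rewrite leq_eqVlt => /orP[/eqP eqij|ltij].
- by rewrite eqij subnn addn0; have -> : i = Ordinal jk by apply: val_inj.
- by [].
- by rewrite eqij subnn addn0; have -> : i = Ordinal jk by apply: val_inj.
have jk' : (j < k)%N by apply: ltnW.
have := IHj jk' ltij; have := fP (Ordinal jk') (Ordinal jk) (ltnSn j) => /=.
by lia.
Qed.

Lemma increasing_ge f (i : 'I_k) : increasing f -> (i <= f i)%N.
Proof.
move=> fP; have k0 : (0 < k)%N by apply: leq_ltn_trans (ltn_ord i).
by have := @increasing_gap f (Ordinal k0) i fP (leq0n _) => /=; lia.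
Qed.

End IncreasingMaps.

Lemma increasing_endo k (f : {ffun 'I_k -> 'I_k}) :
  increasing f -> forall i, f i = i.
Proof.
move=> fP i; have k0 : (0 < k)%N by apply: leq_ltn_trans (ltn_ord i).
have k1 : (k.-1 < k)%N by rewrite prednK.
apply: val_inj => /=; have := increasing_ge i fP.
have := @increasing_gap _ _ f i (Ordinal k1) fP.
by have := ltn_ord (f (Ordinal k1)); have := ltn_ord i; move=> /=; lia.
Qed.

(** Writing [f i = g (h i)], the reindexing [h] is an increasing self-map of ['I_k], hence the
    identity. *)
Lemma increasing_sub_eq k n (f g : {ffun 'I_k -> 'I_n}) :
  increasing f -> increasing g -> (forall i, exists j, f i = g j) -> f = g.
Proof.
move=> fP gP /fin_all_exists[h hP].
have h_incr : increasing [ffun i => h i].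
  apply/increasingP=> i j; rewrite !ffunE => ltij.
  move/increasingP: fP => /(_ i j ltij); rewrite !hP.
  case: (ltngtP (h i) (h j)) => //; last by move=> /val_inj ->; rewrite ltnn.
  by move=> lt; move/increasingP: gP => /(_ _ _ lt); lia.
apply/ffunP=> i; rewrite hP; congr (g _).
by have := increasing_endo h_incr i; rewrite ffunE.
Qed.

(** * The sum of maximal minors as an alternating form *)

Section MinorSum.
Variable F : fieldType.

Definition minor_sum n k (X : 'M[F]_(n, k)) : F :=
  \sum_(f : {ffun 'I_k -> 'I_n} | increasing f) \det (rowsub f X).

(* Relative invariance under right multiplication encodes antisymmetry. *)
Definition alternating_form n k (w : 'M[F]_(n, k) -> F) : Prop :=
  (forall X P, w (X *m P) = w X * \det P) /\
  (forall (j : 'I_k) (a : F) (A B C : 'M[F]_(n, k)),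
     (forall i l, l != j -> B i l = A i l /\ C i l = A i l) ->
     (forall i, A i j = a * B i j + C i j) -> w A = a * w B + w C).

Lemma minor_sum_alternating n k : alternating_form (@minor_sum n k).
Proof.
split=> [X P | j a A B C eqBC eqA]; rewrite /minor_sum.
  rewrite mulr_suml; apply: eq_bigr => f _; rewrite -det_mulmx; congr (\det _).
  by apply/matrixP=> i j; rewrite !mxE; apply: eq_bigr => l _; rewrite mxE.
rewrite mulr_sumr -big_split; apply: eq_bigr => f _ /=.
rewrite -[X in X = _]det_tr -(det_tr (rowsub f B)) -(det_tr (rowsub f C)).
rewrite -[X in _ + X]mul1r; apply: (@determinant_multilinear _ _ _ _ _ j).
- by apply/rowP=> i; rewrite !mxE eqA mul1r.
- apply/matrixP=> i l; rewrite !mxE.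
  by case: (eqBC (f l) (lift j i)) => [|-> _//]; rewrite eq_sym neq_lift.
- apply/matrixP=> i l; rewrite !mxE.
  by case: (eqBC (f l) (lift j i)) => [|_ ->//]; rewrite eq_sym neq_lift.
Qed.

(** The rows picked by [f] form the identity matrix, while any other increasing map picks a row
    outside the image of [f], which is zero. *)
Lemma minor_sum_unit n k (f : {ffun 'I_k -> 'I_n}) :
  increasing f -> minor_sum (\matrix_(i, j) (i == f j)%:R) = 1.
Proof.
move=> fP; rewrite /minor_sum (bigD1 f) //= big1 => [|g /andP[gP neqgf]].
  rewrite addr0 -[RHS](det1 _ k); congr (\det _); apply/matrixP=> i j.
  by rewrite !mxE (inj_eq (increasing_inj fP)).
have [/forallP sub | ] := boolP [forall i, exists j, g i == f j].
  case/eqP: neqgf; apply: increasing_sub_eq => // i.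
  by have /existsP[j /eqP ->] := sub i; exists j.
rewrite negb_forall => /existsP[i]; rewrite negb_exists => /forallP gi.
rewrite (expand_det_row _ i) big1 // => j _.
by rewrite !mxE (negPf (gi j)) mul0r.
Qed.

(** By linearity in row [j], the determinant is minus that of a matrix with two equal rows. No
    division by 2 occurs, so characteristic 2 is covered. *)
Lemma det_opp_rows k (A : 'M[F]_k) (i j : 'I_k) :
  i != j -> (forall l, A j l = - A i l) -> \det A = 0.
Proof.
move=> neqij Aij.
pose B : 'M[F]_k := \matrix_(x, y) if x == j then A i y else A x y.
have B0 : \det B = 0.
  apply: (determinant_alternate neqij) => y.
  by rewrite !mxE eqxx (negPf neqij).
have Brow : row' j B = row' j A.
  by apply/matrixP=> x y; rewrite !mxE eq_sym (negPf (neq_lift _ _)).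
rewrite (@determinant_multilinear _ _ A B B j (-1) 0) // ?B0 ?mulr0 ?addr0 //.
by apply/rowP=> y; rewrite !mxE eqxx Aij mul0r addr0 mulN1r.
Qed.

(* The minors that use exactly one of the two rows cancel in pairs. *)
Lemma minor_sum_opp_rows n k (X Y : 'M[F]_(n, k)) (a b : 'I_n) :
  b = a.+1 :> nat -> (forall j, X b j = - X a j) ->
  (forall j, Y a j = 0 /\ Y b j = 0) ->
  (forall i j, i != a -> i != b -> Y i j = X i j) ->
  minor_sum X = minor_sum Y.
Proof.
move=> ab Xab Y0 YX.
have neqab : a != b by apply/eqP=> eqab; move: ab; rewrite eqab; lia.
pose ina (f : {ffun 'I_k -> 'I_n}) := [exists i, f i == a].
pose inb (f : {ffun 'I_k -> 'I_n}) := [exists i, f i == b].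
have detY0 f : ina f || inb f -> \det (rowsub f Y) = 0.
  case/orP=> /existsP[i /eqP fi]; rewrite (expand_det_row _ i) big1 // => j _;
  by rewrite !mxE fi ?(proj1 (Y0 j)) ?(proj2 (Y0 j)) mul0r.
rewrite /minor_sum (bigID (fun f => ina f || inb f)) /=.
rewrite [RHS](bigID (fun f => ina f || inb f)) /=.
rewrite [X in _ = X + _]big1 => [|f /andP[_ /detY0]//]; congr (_ + _); last first.
  apply: eq_bigr => f /andP[_ /norP[/existsPn fa /existsPn fb]].
  by congr (\det _); apply/matrixP=> i j; rewrite !mxE YX.
rewrite (bigID ina) /= (bigID inb) /= big1 ?add0r => [|f]; last first.
  case/andP=> /andP[_ /existsP[i /eqP fi]] /existsP[j /eqP fj].
  apply: (@det_opp_rows _ _ i j) => [|l]; last by rewrite !mxE fi fj Xab.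
  by apply: contraNneq neqab => eqij; rewrite -fi -fj eqij.
(* Exchanging the adjacent indices [a] and [b] keeps a map increasing unless it uses both, since no
   index lies between them. *)
pose h (f : {ffun 'I_k -> 'I_n}) := [ffun i => tperm a b (f i)].
have hK : involutive h by move=> f; apply/ffunP=> i; rewrite !ffunE tpermK.
have hina f : ina (h f) = inb f.
  apply: eq_existsb => i; rewrite ffunE -(inj_eq (@perm_inj _ (tperm a b))).
  by rewrite tpermK tpermL.
have hinb f : inb (h f) = ina f by rewrite -hina hK.
have neqv (x y : 'I_n) : x <> y -> (x : nat) <> y by move=> neq /val_inj.
have h_incr f : ~~ (ina f && inb f) -> increasing f -> increasing (h f).
  move=> nab /increasingP fP; apply/increasingP=> i j ltij; rewrite !ffunE.
  have ltf := fP i j ltij; move: nab; rewrite negb_and => /orP nab.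
  case: tpermP => [fi|fi|/neqv ia /neqv ib]; case: tpermP => [fj|fj|/neqv ja /neqv jb];
    move: ltf; rewrite ?fi ?fj ?ltnn ?ab //; try by move=> *; lia.
  by case: nab => /existsPn nf; [have := nf i | have := nf j]; rewrite ?fi ?fj eqxx.
have h_incrE f : ~~ inb f -> increasing (h f) = increasing f.
  move=> nb; apply/idP/idP => [/h_incr|]; last by apply: h_incr; rewrite negb_and nb orbT.
  by rewrite hK; apply; rewrite hina negb_and nb.
rewrite [X in _ + X](reindex_inj (inv_inj hK)) /=.
rewrite [X in _ + X](eq_bigl (fun f => [&& increasing f && (ina f || inb f),
    ina f & ~~ inb f])) => [|f]; last first.
  rewrite hina hinb; case: (boolP (inb f)) => [|nb]; first by rewrite !andbF.
  by rewrite h_incrE // orbF orFb !andbT -andbA andbb.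
rewrite [X in X + _](eq_bigl (fun f => [&& increasing f && (ina f || inb f),
    ina f & ~~ inb f])) => [|f]; last by rewrite -!andbA.
rewrite -big_split big1 //= => f /and3P[fP /existsP[i /eqP fi] /existsPn fb].
rewrite (@determinant_multilinear _ _ (rowsub (h f) X) (rowsub f X) (rowsub f X) i (-1) 0).
- by rewrite mul0r addr0 mulN1r subrr.
- by apply/rowP=> l; rewrite !mxE ffunE fi tpermL Xab mulN1r mul0r addr0.
- apply/matrixP=> x y; rewrite !mxE ffunE tpermD // ?[b == _]eq_sym // -fi.
  by rewrite (inj_eq (increasing_inj (proj1 (andP fP)))) neq_lift.
- apply/matrixP=> x y; rewrite !mxE ffunE tpermD // ?[b == _]eq_sym // -fi.
  by rewrite (inj_eq (increasing_inj (proj1 (andP fP)))) neq_lift.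
Qed.
End MinorSum.

(** * Inserting a value into an increasing map *)

Section Insertion.
Variables k n : nat.
Implicit Types (p : 'I_k.+1) (i : 'I_n) (g : {ffun 'I_k -> 'I_n}).

Definition insert p i g : {ffun 'I_k.+1 -> 'I_n} :=
  [ffun x => if unlift p x is Some j then g j else i].

Lemma insert_at p i g : insert p i g p = i.
Proof. by rewrite ffunE unlift_none. Qed.

Lemma insert_lift p i g j : insert p i g (lift p j) = g j.
Proof. by rewrite ffunE liftK. Qed.

Lemma increasing_insert p i g :
  increasing (insert p i g) =
  increasing g && [forall j : 'I_k, if (j < p)%N then (g j < i)%N else (i < g j)%N].
Proof.
apply/increasingP/andP => [fP | [/increasingP gP /forallP ip] x y].
  split.
    apply/increasingP=> x y ltxy; rewrite -(insert_lift p i g x) -(insert_lift p i g y).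
    by apply: fP; rewrite /= /bump; lia.
  apply/forallP=> j; have := fP p (lift p j); have := fP (lift p j) p.
  by rewrite insert_at insert_lift /= /bump; case: (ltnP j p) => ltjp; lia.
case: (unliftP p x) => [x' ->|->]; case: (unliftP p y) => [y' ->|->];
  rewrite ?insert_at ?insert_lift ?ltnn //= /bump => ltxy.
- by apply: gP; lia.
- by move: ltxy (ip x'); case: (ltnP x' p) => // lep; rewrite [(_ < p)%N]ltnNge add1n leqW.
- by move: ltxy (ip y'); case: (ltnP y' p) => // ltp; rewrite [(p < _)%N]ltnNge add0n ltnW.
Qed.

(** The position is the number of values of [g] below [i], found as the least [m] from which on all
    values exceed [i]. *)
Lemma insert_position i g :
  increasing g -> (forall j, g j != i) ->
  exists p, forall q, increasing (insert q i g) = (q == p).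
Proof.
move=> gP gi; pose above m := [forall j : 'I_k, (m <= j)%N ==> (i < g j)%N].
have exm : exists m, above m.
  by exists k; apply/forallP=> j; rewrite leqNgt ltn_ord.
case: (ex_minnP exm) => m /forallP m_above m_min.
have lemk : (m < k.+1)%N.
  by apply: m_min; apply/forallP=> j; rewrite leqNgt ltn_ord.
have below (j : 'I_k) : (j < m)%N -> (g j < i)%N.
  move=> ltjm; have nm : ~~ above m.-1 by apply/negP=> /m_min; lia.
  move: nm; rewrite negb_forall => /existsP[l]; rewrite negb_imply => /andP[lel ltl].
  have ltlm : (l < m)%N.
    by rewrite ltnNge; apply: contra ltl => lem; apply: (implyP (m_above l)).
  have := increasing_gap gP (_ : (j <= l)%N); have : (g l : nat) <> i.
    by move=> /val_inj eqgl; move: (gi l); rewrite eqgl eqxx.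
  by lia.
exists (Ordinal lemk) => q; rewrite increasing_insert gP /=.
apply/forallP/eqP => [qP | -> j]; last first.
  by case: ltnP => [/below//|lem]; apply: (implyP (m_above j)).
apply: val_inj => /=; case: (ltngtP q m) => // ltqm.
  have ltqk : (q < k)%N by apply: leq_trans ltqm _.
  by have := qP (Ordinal ltqk); have := below (Ordinal ltqk) ltqm; rewrite /= ltnn; lia.
have ltmk : (m < k)%N by apply: leq_trans ltqm _; rewrite -ltnS.
have := qP (Ordinal ltmk); have := implyP (m_above (Ordinal ltmk)) (leqnn _).
by rewrite /= ltqm; lia.
Qed.

End Insertion.

(** * Exterior product with the column-sum functional *)

Section Wedge.
Variable F : fieldType.

Lemma sum_signs m : \sum_(i < m) (-1) ^+ i = (odd m)%:R :> F.
Proof.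
elim: m => [|m IHm]; first by rewrite big_ord0.
rewrite big_ord_recr /= IHm -signr_odd.
by case: (odd m); rewrite ?expr1 ?expr0 ?subrr ?add0r.
Qed.

(* Exterior product with the column-sum functional: an increasing (k+1)-tuple
   arises from [k + 1] insertions, whose alternating signs add up to one. *)
Lemma minor_sum_wedge n k (Z : 'M[F]_(n, k.+1)) :
  ~~ odd k ->
  minor_sum Z = \sum_(j < k.+1) (-1) ^+ j * (\sum_i Z i j) * minor_sum (col' j Z).
Proof.
move=> evenk.
(* [G i g] is the Laplace expansion of the determinant with row [i] on top of the rows of [g];
   inserting at position [p] instead only costs the sign of [p]. *)
pose G i (g : {ffun 'I_k -> 'I_n}) :=
  \sum_(j < k.+1) (-1) ^+ j * Z i j * \det (rowsub g (col' j Z)).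
have detG p i g : \det (rowsub (insert p i g) Z) = (-1) ^+ p * G i g.
  rewrite (expand_det_row _ p) mulr_sumr; apply: eq_bigr => j _.
  rewrite !mxE insert_at /cofactor.
  have -> : row' p (col' j (rowsub (insert p i g) Z)) = rowsub g (col' j Z).
    by apply/matrixP=> x y; rewrite !mxE insert_lift.
  by rewrite exprD; ring.
have minorG (p : 'I_k.+1) : (-1) ^+ p * minor_sum Z =
    \sum_(ig : 'I_n * {ffun 'I_k -> 'I_n})
      if increasing (insert p ig.1 ig.2) then G ig.1 ig.2 else 0.
  rewrite -big_mkcond /= /minor_sum mulr_sumr.
  rewrite (reindex (fun ig : 'I_n * {ffun 'I_k -> 'I_n} => insert p ig.1 ig.2)) /=.
    by apply: eq_bigr => ig _; rewrite detG signrMK.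
  exists (fun f : {ffun 'I_k.+1 -> 'I_n} => (f p, [ffun x => f (lift p x)])) => [[i g] _|f _] /=.
    by rewrite insert_at; congr (_, _); apply/ffunP=> x; rewrite ffunE insert_lift.
  apply/ffunP=> x; case: (unliftP p x) => [y ->|->]; last by rewrite insert_at.
  by rewrite insert_lift ffunE.
have -> : minor_sum Z = \sum_(p < k.+1) (-1) ^+ p * minor_sum Z.
  by rewrite -mulr_suml sum_signs /= evenk mul1r.
under eq_bigr do rewrite minorG.
rewrite exchange_big /=.
(* For increasing [g], a value [i] outside its image has exactly one admissible position; for [i] in
   the image, [G i g] vanishes because a row is repeated. *)
transitivity (\sum_(ig : 'I_n * {ffun 'I_k -> 'I_n} | increasing ig.2) G ig.1 ig.2).
  rewrite [RHS]big_mkcond; apply: eq_bigr => [[i g] _] /=; case: ifP => [gP | ngP].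
    have [/existsP[l /eqP gl] | /existsPn gi] := boolP [exists l, g l == i].
      have -> : G i g = 0.
        rewrite -[LHS]mul1r -[1](expr0 (-1)) -(detG ord0).
        apply: (@determinant_alternate _ _ _ ord0 (lift ord0 l)) => // y.
        by rewrite !mxE insert_at insert_lift gl.
      by rewrite big1 // => p _; case: ifP.
    have [p pP] := insert_position gP gi.
    by under eq_bigr do rewrite pP; rewrite -big_mkcond big_pred1_eq.
  by rewrite big1 // => p _; rewrite increasing_insert ngP.
rewrite -(pair_big_dep xpredT (fun _ g => increasing g) G) /= exchange_big /=.
rewrite /G /minor_sum; under eq_bigr do rewrite exchange_big /=.
rewrite exchange_big; apply: eq_bigr => j _ /=.
rewrite mulr_sumr; apply: eq_bigr => g _.
by rewrite -mulr_suml -mulr_sumr.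
Qed.

End Wedge.

(** * Contractions, radicals and the codimension bound *)

Section AlternatingForms.
Variable F : fieldType.

Local Notation e0 := (delta_mx 0%R 0%R).

Lemma vspace_eq0 (U : vectType F) (V : {vspace U}) : (V <= 0)%VS -> V = 0%VS.
Proof. by rewrite subv0 => /eqP. Qed.

(** In the rank normal form of [v], the left factor is a nonzero scalar and [v] is that scalar times
    the first row of [row_ebase v]. This lets later arguments treat only the first column. *)
Lemma row_to_delta k (v : 'rV[F]_k.+1) :
  v != 0 -> exists2 P, P \in unitmx & v *m P = delta_mx 0 0.
Proof.
move=> nzv; pose c := col_ebase v 0 0.
have rk : \rank v = 1%N by rewrite rank_rV nzv.
have cunit : c \is a GRing.unit.
  by have := col_ebase_unit v; rewrite unitmxE det_mx11.
have nzc : c != 0 by rewrite -unitfE.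
exists (c^-1 *: invmx (row_ebase v)).
  by rewrite unitmxZ ?unitmx_inv ?row_ebase_unit // unitrV.
rewrite -{1}(mulmx_ebase v) rk -scalemxAr mulmxK ?row_ebase_unit //.
rewrite [col_ebase v]mx11_scalar mul_scalar_mx scalerA mulVf // scale1r.
apply/matrixP=> i j; rewrite !mxE !ord1 /=.
case: (j =P 0) => [->//|/eqP neqj].
by rewrite eq_sym (_ : (j : nat) == 0%N = false) //; apply/negbTE.
Qed.

Lemma altform_contract n k (w : 'M[F]_(n, 1 + k) -> F) (u : 'cV[F]_n) :
  alternating_form w -> alternating_form (fun Y : 'M_(n, k) => w (row_mx u Y)).
Proof.
move=> [wM wD]; split=> [X P | j a A B C eqBC eqA].
  have -> : row_mx u (X *m P) = row_mx u X *m block_mx 1%:M 0 0 P.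
    by rewrite mul_row_block !mulmx0 mulmx1 addr0 add0r.
  by rewrite wM det_ublock det1 mul1r.
apply: (wD (rshift 1 j)) => [i l | i]; last by rewrite !row_mxEr.
case: (split_ordP l) => m ->; first by rewrite !row_mxEl.
by rewrite (inj_eq (@rshift_inj _ _)) !row_mxEr; apply: eqBC.
Qed.

(** Complete [c] to an invertible matrix with first column [c]. Multiplying [X] by it puts the
    radical vector [X *m c] in the first column and changes [w X] only by a nonzero determinant. *)
Lemma altform_radical n k (w : 'M[F]_(n, 1 + k) -> F) (X : 'M_(n, 1 + k))
    (c : 'cV_(1 + k)) :
  alternating_form w -> c != 0 -> (forall Y, w (row_mx (X *m c) Y) = 0) -> w X = 0.
Proof.
move=> [wM _] nzc rad; have nzct : c^T != 0 by rewrite trmx_eq0.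
have [P Pu cP] := row_to_delta nzct.
have Qu : (invmx P)^T \in unitmx by rewrite unitmx_tr unitmx_inv.
have colQ : lsubmx (X *m (invmx P)^T : 'M_(n, 1 + k)) = X *m c.
  have -> : c = (invmx P)^T *m delta_mx 0 0.
    by rewrite -[LHS]trmxK -(mulmxK Pu c^T) cP trmx_mul trmx_delta.
  rewrite mulmxA -colE; apply/colP=> i; rewrite mxE [RHS]mxE.
  by congr (_ _ _); apply: val_inj.
have := wM X (invmx P)^T; rewrite -[X in w X = _]hsubmxK colQ rad => /esym/eqP.
rewrite mulf_eq0 => /orP[/eqP//|]; move: Qu; rewrite unitmxE unitfE => nz.
by rewrite (negPf nz).
Qed.

(** The kernel of the map sending [u] to [u *m v] modulo [V], so its codimension is the rank of that
    map. For [v = e0] it describes the matrices of [V] supported on the first column. *)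
Definition column_space n k (v : 'rV[F]_k) (V : {vspace 'M[F]_(n, k)}) : {vspace 'cV[F]_n} :=
  (linfun (mulmxr v) @^-1: V)%VS.

Lemma column_spaceE n k (v : 'rV[F]_k) (V : {vspace 'M[F]_(n, k)}) u :
  (u \in column_space v V) = (u *m v \in V).
Proof. by rewrite -memv_preim lfunE. Qed.

Lemma leq_dim_limg (U W : vectType F) (f : 'Hom(U, W)) (V : {vspace U}) :
  (\dim (f @: V) <= \dim V)%N.
Proof. by rewrite -(limg_ker_dim f V) leq_addl. Qed.

Lemma dim_cV n : dim 'cV[F]_n = n.
Proof. exact: muln1. Qed.

Lemma leq_dim_matrix m n (V : {vspace 'M[F]_(m, n)}) : (\dim V <= m * n)%N.
Proof. by have := dimvS (subvf V); rewrite dimvf dim_matrix. Qed.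

Lemma leq_dim_cV n (V : {vspace 'cV[F]_n}) : (\dim V <= n)%N.
Proof. by have := leq_dim_matrix V; rewrite muln1. Qed.

Lemma mul_delta0 n k (u : 'cV[F]_n) :
  u *m delta_mx 0 0 = row_mx u (0 : 'M_(n, k)) :> 'M_(n, 1 + k).
Proof.
apply/matrixP=> i j; rewrite mxE big_ord1 !mxE eqxx /=.
case: splitP => l eqj; last by rewrite !mxE -val_eqE /= eqj mulr0.
by rewrite ord1 -val_eqE /= eqj !ord1 mulr1.
Qed.

(** Rank-nullity on [V] for the projection that forgets the first column. *)
Lemma dim_column_space n k (V : {vspace 'M[F]_(n, 1 + k)}) :
  (\dim V <= \dim (column_space e0 V) + \dim (linfun rsubmx @: V))%N.
Proof.
rewrite -(limg_ker_dim (linfun rsubmx) V) leq_add2r.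
apply: leq_trans (leq_dim_limg (linfun (mulmxr e0)) _).
apply: dimvS; apply/subvP=> X /memv_capP[XV]; rewrite memv_ker lfunE /= => /eqP X0.
have eqX : X = lsubmx X *m delta_mx 0 0 by rewrite mul_delta0 -X0 hsubmxK.
apply/memv_imgP; exists (lsubmx X); last by rewrite lfunE.
by rewrite column_spaceE -eqX.
Qed.

(** By [altform_radical], [X] acts injectively on column vectors and its image, of dimension
    [1 + k], meets [U] only in 0. *)
Lemma dim_radical n k (w : 'M[F]_(n, 1 + k) -> F) X (U : {vspace 'cV[F]_n}) :
  alternating_form w -> w X != 0 ->
  (forall u, u \in U -> forall Y, w (row_mx u Y) = 0) -> (\dim U + (1 + k) <= n)%N.
Proof.
move=> walt nzX radU; pose f : 'Hom('cV[F]_(1 + k), 'cV[F]_n) := linfun (mulmx X).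
have fU c : f c \in U -> c = 0.
  rewrite lfunE /= => /radU rad; apply/eqP; apply: contraNT nzX => nzc.
  exact/eqP/(altform_radical walt nzc).
have capUf : (U :&: limg f = 0)%VS.
  apply: vspace_eq0; apply/subvP=> u /memv_capP[uU /memv_imgP[c _ eqc]].
  by rewrite eqc in uU *; rewrite (fU c uU) linear0 mem0v.
have kerf : ({:'cV[F]_(1 + k)} :&: lker f = 0)%VS.
  apply: vspace_eq0; apply/subvP=> c /memv_capP[_]; rewrite memv_ker.
  by move=> /eqP fc; rewrite (fU c) ?mem0v // fc mem0v.
have dimf : \dim (limg f) = (1 + k)%N by rewrite (limg_dim_eq kerf) dimvf dim_cV.
by rewrite -dimf -dimv_disjoint_sum // leq_dim_cV.
Qed.

(** Some element of [s + V] has [Y] as its last columns, and adding [u] to its first column stays in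
    [s + V]. Additivity in that column isolates the contraction by [u]. *)
Lemma altform_contract_vanish n k (w : 'M[F]_(n, 1 + k) -> F)
    (s : 'M[F]_(n, 1 + k)) (V : {vspace 'M[F]_(n, 1 + k)}) (u : 'cV[F]_n) (Y : 'M[F]_(n, k)) :
  alternating_form w -> (forall X, X - s \in V -> w X = 0) ->
  u \in column_space e0 V ->
  Y - rsubmx s \in (linfun rsubmx @: V)%VS -> w (row_mx u Y) = 0.
Proof.
move=> [_ wD] w0; rewrite column_spaceE mul_delta0 => uV /memv_imgP[X XV].
rewrite lfunE /= => /eqP; rewrite subr_eq => /eqP eqY.
have wXs : w (row_mx (lsubmx (X + s)) Y) = 0.
  by apply: w0; rewrite eqY -linearD /= hsubmxK addrK.
have := w0 (row_mx (u + lsubmx (X + s)) Y).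
rewrite (wD (lshift k 0) 1 _ (row_mx u Y) (row_mx (lsubmx (X + s)) Y)).
- rewrite wXs mul1r addr0; apply; rewrite eqY.
  have -> : row_mx (u + lsubmx (X + s)) (rsubmx X + rsubmx s) = row_mx u 0 + (X + s).
    by rewrite -{2}[X + s]hsubmxK add_row_mx add0r [rsubmx (X + s)]linearD.
  by rewrite addrA addrK rpredD.
- move=> i l; case: (split_ordP l) => m ->; last by rewrite !row_mxEr.
  by rewrite ord1 eqxx.
- by move=> i; rewrite !row_mxEl !mxE mul1r.
Qed.

Lemma mulmx_preim n k (V : {vspace 'M[F]_(n, k)}) (P : 'M_k) :
  P \in unitmx ->
  exists2 W : {vspace 'M[F]_(n, k)}, \dim W = \dim V &
    forall X, (X \in W) = (X *m P \in V).
Proof.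
move=> Pu; pose f : 'End('M[F]_(n, k)) := linfun (mulmxr P).
have kerf : lker f = 0%VS.
  apply: vspace_eq0; apply/subvP=> X; rewrite memv_ker lfunE /= => /eqP XP.
  by rewrite -(mulmxK Pu X) XP mul0mx mem0v.
exists (f @^-1: V)%VS; last by move=> X; rewrite -memv_preim lfunE.
rewrite -(@limg_dim_eq _ _ _ f) ?kerf ?capv0 // lpreimK //.
apply/subvP=> X _; apply/memv_imgP; exists (X *m invmx P); first exact: memvf.
by rewrite lfunE /= mulmxKV.
Qed.

Lemma linear_span_delta n k (V : {vspace 'M[F]_(n, k)}) :
  (forall i j, delta_mx i j \in V) -> forall X, X \in V.
Proof.
move=> dV X; rewrite [X]matrix_sum_delta.
by apply: rpred_sum => i _; apply: rpred_sum => j _; apply: rpredZ.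
Qed.

Theorem altform_codim n k (w : 'M[F]_(n, k) -> F)
    (s : 'M[F]_(n, k)) (V : {vspace 'M[F]_(n, k)}) (X0 : 'M[F]_(n, k)) :
  alternating_form w -> w X0 != 0 -> (forall X, X - s \in V -> w X = 0) ->
  (\dim V + k <= n * k)%N.
Proof.
elim: k w s V X0 => [|k IHk] w s V X0 walt nzX0 w0.
  by rewrite addn0 leq_dim_matrix.
have main s1 (V1 : {vspace 'M[F]_(n, 1 + k)}) (i : 'I_n) :
    (forall X, X - s1 \in V1 -> w X = 0) -> delta_mx i 0 \notin V1 ->
    (\dim V1 + k.+1 <= n * k.+1)%N.
  move=> w1 Ni; have dimV := dim_column_space V1.
  have dimI := leq_dim_matrix (linfun rsubmx @: V1)%VS.
  apply: contraT; rewrite -ltnNge => big; exfalso.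
  (* A proper column space supplies the missing unit: added to the inductive bound for a nonzero
     contraction, it gives the claim. *)
  have dimU : (\dim (column_space e0 V1) < n)%N.
    rewrite ltn_neqAle leq_dim_cV andbT; apply: contra Ni => /eqP dimU.
    have -> : delta_mx i 0 = (delta_mx i 0 : 'cV_n) *m e0 :> 'M[F]_(n, 1 + k).
      by rewrite mul_delta_mx.
    rewrite -column_spaceE; have /eqP -> : column_space e0 V1 == fullv.
      by rewrite eqEdim subvf dimvf dim_cV dimU leqnn.
    exact: memvf.
  have not_le : ~ (\dim (column_space e0 V1) + \dim (linfun rsubmx @: V1) + k.+1 <= n + n * k)%N.
    move=> le1; move: big; rewrite ltnNge => /negP[]; rewrite mulnS.
    by apply: leq_trans le1; rewrite leq_add2r.
  have rad u : u \in column_space e0 V1 -> forall Y, w (row_mx u Y) = 0.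
    move=> uU Y; apply/eqP; apply: contraT => nz; exfalso.
    have := IHk _ (rsubmx s1) (linfun rsubmx @: V1)%VS Y (altform_contract u walt) nz.
    move/(_ (fun Y' => @altform_contract_vanish _ _ _ _ _ _ Y' walt w1 uU)) => le2.
    by apply: not_le; rewrite addnS -addnA -addSn; apply: leq_add.
  have leU := dim_radical walt nzX0 rad.
  by apply: not_le; rewrite addnAC; apply: leq_add.
have [/forallP dV | ] := boolP [forall i, forall j, delta_mx i j \in V].
  case/eqP: nzX0; apply/w0/linear_span_delta => i j.
  exact: (forallP (dV i) j).
rewrite negb_forall => /existsP[i]; rewrite negb_forall => /existsP[j Nij].
(* Exchanging columns [0] and [j] moves the missing matrix unit into the first column. *)
have Pu : (tperm_mx 0 j : 'M[F]_k.+1) \in unitmx by apply: unitmx_perm.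
have [W <- WE] := mulmx_preim V Pu.
have PK : (tperm_mx 0 j : 'M[F]_k.+1) *m tperm_mx 0 j = 1%:M.
  by rewrite -perm_mxM tperm2 perm_mx1.
apply: (main (s *m tperm_mx 0 j) W i) => [X|].
  rewrite WE mulmxBl -mulmxA PK mulmx1 => /w0; rewrite (proj1 walt) => /eqP.
  rewrite mulf_eq0 => /orP[/eqP//|]; move: Pu; rewrite unitmxE unitfE => nz.
  by rewrite (negPf nz).
rewrite WE (_ : _ *m _ = delta_mx i j) //.
rewrite -xcolE; apply/matrixP=> x y; rewrite !mxE -(inj_eq (@perm_inj _ (tperm 0 j))).
by rewrite tpermK tpermL.
Qed.
End AlternatingForms.

(** * Linear families of maps of rank at most one *)

Section RankOne.
Variable F : fieldType.

(* Modulo [V], the maps [u |-> u *m v] form a linear family of maps of rank at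
   most one.  Such a family has a common kernel or a common image line; the
   second alternative would force the codimension of [V] to be at most one. *)
Lemma rank_one_hyperplane n k (V : {vspace 'M[F]_(n, k)}) :
  (0 < k)%N -> (\dim V + k = n * k)%N ->
  (forall v : 'rV_k, v != 0 -> (n <= \dim (column_space v V) + 1)%N) ->
  exists2 phi : 'rV[F]_n, phi != 0 & forall X, phi *m X = 0 -> X \in V.
Proof.
(* The projection [g] has kernel [V] and stands in for the quotient map modulo [V]. *)
move=> k0 dimV bigV; pose g : 'End('M[F]_(n, k)) := (\1 - projv V)%VF.
have gE X : (g X == 0) = (X \in V).
  rewrite !lfun_simp /= subr_eq0; apply/eqP/idP => [-> | /projv_id//].
  exact: memv_proj.
pose T (v : 'rV[F]_k) (u : 'cV[F]_n) := g (u *m v).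
have TE v u : (T v u == 0) = (u \in column_space v V) by rewrite gE column_spaceE.
have TDl a b u : T (a + b) u = T a u + T b u by rewrite /T mulmxDr linearD.
have TB v x y : T v (x - y) = T v x - T v y by rewrite /T mulmxBl linearB.
have TZ v c x : T v (c *: x) = c *: T v x by rewrite /T -scalemxAl linearZ.
have rank1 v x z : T v x != 0 -> exists c, T v z = c *: T v x.
  move=> nzx; have nzv : v != 0.
    by apply: contraNneq nzx => ->; rewrite /T mulmx0 linear0.
  have capx : (column_space v V :&: <[x]> = 0)%VS.
    apply: vspace_eq0; apply/subvP=> y /memv_capP[yV /vlineP[c eqy]].
    move: yV; rewrite -TE eqy TZ scaler_eq0 (negPf nzx) orbF => /eqP ->.
    by rewrite scale0r mem0v.
  have nz_x : x != 0 by apply: contraNneq nzx => ->; rewrite /T mul0mx linear0.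
  have /eqP full : (column_space v V + <[x]>)%VS == fullv.
    rewrite eqEdim subvf dimvf dim_cV dimv_disjoint_sum // dim_vline nz_x.
    exact: bigV.
  have : z \in (column_space v V + <[x]>)%VS by rewrite full memvf.
  move=> /memv_addP[y yV [_ /vlineP[c ->] ->]]; exists c.
  move: yV; rewrite -TE => /eqP Ty; rewrite -TZ; apply/eqP; rewrite -subr_eq0 -TB.
  by rewrite addrK Ty.
(* If [T a z] were nonzero, it would span the image of [T (a + b)], as [T b z = 0]; then [T b y]
   would lie on the image line of [T a]. *)
have kerT a b x y z : T a x != 0 -> T b y \notin <[T a x]>%VS -> T b z = 0 -> T a z = 0.
  move=> nzx Ny Tbz; apply/eqP; apply: contraNT Ny => nzz.
  have [c] : exists c, T (a + b) y = c *: T (a + b) z.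
    by apply: rank1; rewrite TDl Tbz addr0.
  have [c1 Tay] := rank1 a x y nzx; have [c2 Taz] := rank1 a x z nzx.
  rewrite !TDl Tbz addr0 Tay Taz => eqT.
  have -> : T b y = c *: (c2 *: T a x) - c1 *: T a x by rewrite -eqT addrAC subrr add0r.
  by rewrite rpredB ?rpredZ ?memv_line.
have [j [x nzx kerj]] : exists j : 'I_k, exists2 x, T (delta_mx 0 j) x != 0 &
    forall i z, T (delta_mx 0 j) z = 0 -> T (delta_mx 0 i) z = 0.
  have [/forallP dV | ] := boolP [forall l, forall j, delta_mx l j \in V].
    have : (\dim V = n * k)%N.
      have -> : V = fullv.
        apply/vspaceP=> X; rewrite memvf; apply: linear_span_delta => l j.
        exact: (forallP (dV l) j).
      by rewrite dimvf.
    by move=> eqV; move: dimV k0; rewrite eqV; lia.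
  rewrite negb_forall => /existsP[l]; rewrite negb_forall => /existsP[j Nlj].
  have dT i m : T (delta_mx 0 i) (delta_mx m 0) = g (delta_mx m i).
    by rewrite /T mul_delta_mx.
  pose q := g (delta_mx l j); have nzq : q != 0 by rewrite gE.
  (* If all values of [g] lie on one line, then [V] has codimension at most one, so [k = 1] and
     there is only one index to compare. *)
  have [/forallP allq | ] := boolP [forall m, forall i, g (delta_mx m i) \in <[q]>%VS].
    have k1 : k = 1%N.
      have kerg : lker g = V by apply/vspaceP=> X; rewrite memv_ker gE.
      have limq : (limg g <= <[q]>)%VS.
        apply/subvP=> _ /memv_imgP[X _ ->]; rewrite memv_preim.
        apply: linear_span_delta => m i; rewrite -memv_preim.
        exact: (forallP (allq m) i).
      have := limg_ker_dim g fullv; rewrite capfv kerg dimvf => dimg.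
      have := dimvS limq; rewrite dim_vline nzq => le1.
      have : (\dim V + \dim (limg g) = n * k)%N by exact: dimg.
      by move: dimV le1 k0; move: (\dim _) (\dim _) (n * k)%N; lia.
    exists j; exists (delta_mx l 0) => [|i z]; first by rewrite dT.
    by have -> : i = j by apply: val_inj; move: k1 (ltn_ord i) (ltn_ord j) => /=; lia.
  rewrite negb_forall => /existsP[m]; rewrite negb_forall => /existsP[i Nmi].
  have nzp : g (delta_mx m i) != 0 by apply: contraNneq Nmi => ->; rewrite mem0v.
  exists j; exists (delta_mx l 0) => [|h z Tjz]; first by rewrite dT.
  have Tiz : T (delta_mx 0 i) z = 0.
    apply: (kerT _ (delta_mx 0 j) (delta_mx m 0) (delta_mx l 0)) => //; rewrite !dT //.
    apply: contra Nmi => /vlineP[c eqc].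
    have nzc : c != 0 by apply: contraNneq nzq; rewrite /q eqc => ->; rewrite scale0r.
    by apply/vlineP; exists c^-1; rewrite /q eqc scalerA mulVf // scale1r.
  apply/eqP; apply: contraT => nzr.
  (* The image lines for [i] and [j] are distinct, so the line of [T (delta_mx 0 h) z] differs from
     one of them; [kerT] is applied to that one. *)
  have [/vlineP[c eqc] | Nr] := boolP (T (delta_mx 0 h) z \in <[q]>%VS).
    have nzc : c != 0 by apply: contraNneq nzr; rewrite eqc => ->; rewrite scale0r.
    rewrite -(negPf nzr); apply/eqP.
    apply: (kerT _ (delta_mx 0 i) z (delta_mx m 0)) => //; rewrite !dT.
    apply: contra Nmi => /vlineP[d ->]; rewrite eqc.
    by apply: rpredZ; apply: rpredZ; apply: memv_line.
  rewrite -(negPf nzr); apply/eqP.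
  apply: (kerT _ (delta_mx 0 j) z (delta_mx l 0)) => //; rewrite !dT.
  apply: contra Nr => /vlineP[c eqc].
  have nzc : c != 0 by apply: contraNneq nzq; rewrite /q eqc => ->; rewrite scale0r.
  by apply/vlineP; exists c^-1; rewrite /q eqc scalerA mulVf // scale1r.
have [r [t nzrt]] : exists r t, T (delta_mx 0 j) x r t != 0.
  have [/forallP all0 | ] := boolP [forall r, forall t, T (delta_mx 0 j) x r t == 0].
    case/eqP: nzx; apply/matrixP=> r t; rewrite mxE; apply/eqP.
    exact: (forallP (all0 r) t).
  rewrite negb_forall => /existsP[r]; rewrite negb_forall => /existsP[t nz].
  by exists r, t.
(* As [T (delta_mx 0 j)] has rank one, a coordinate that is nonzero on its image line already
   detects its kernel. *)
pose phi := \row_i T (delta_mx 0 j) (delta_mx i 0) r t.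
have phiE z : (phi *m z) 0 0 = T (delta_mx 0 j) z r t.
  rewrite {2}(matrix_sum_delta z) /T mulmx_suml linear_sum summxE mxE.
  apply: eq_bigr => i _; rewrite big_ord1 mxE -scalemxAl linearZ mxE mulrC.
  by congr (_ * _).
exists phi => [|X phiX].
  by apply: contraNneq nzrt => phi0; rewrite -phiE phi0 mul0mx mxE.
have -> : X = \sum_i col i X *m delta_mx 0 i.
  apply/matrixP=> a b; rewrite summxE (bigD1 b) //= big1 => [|i neqi].
    by rewrite addr0 mxE big_ord1 !mxE !eqxx mulr1.
  by rewrite mxE big_ord1 !mxE eqxx eq_sym (negPf neqi) mulr0.
apply: rpred_sum => i _; rewrite -gE; apply/eqP; apply: kerj.
have [c eqc] := rank1 _ _ (col i X) nzx.
have : (phi *m col i X) 0 0 = 0 by rewrite colE mulmxA phiX mul0mx mxE.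
rewrite phiE eqc mxE => /eqP; rewrite mulf_eq0 (negPf nzrt) orbF => /eqP ->.
by rewrite scale0r.
Qed.
End RankOne.

(** * The radical of the sum of minors *)

Section Vanishing.
Variable F : fieldType.
Local Notation e0 := (delta_mx 0%R 0%R).

Lemma altform_dep n k (w : 'M[F]_(n, 1 + k) -> F) (X : 'M_(n, 1 + k))
    (c : 'cV_(1 + k)) :
  alternating_form w -> c != 0 -> X *m c = 0 -> w X = 0.
Proof.
move=> walt nzc Xc; apply: (altform_radical walt nzc) => Y; rewrite Xc.
have := proj2 walt (lshift k 0) 1 (row_mx 0 Y) (row_mx 0 Y) (row_mx 0 Y).
rewrite mul1r => eqw; apply: (addrI (w (row_mx 0 Y))); rewrite addr0 -eqw // => i.
by rewrite !row_mxEl !mxE mulr0 addr0.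
Qed.

Lemma shift_lt n k t : (k + t <= n)%N -> forall j : 'I_k, (t + j < n)%N.
Proof. by move=> le j; have := ltn_ord j; lia. Qed.

Definition shift_map n k t (le : (k + t <= n)%N) : {ffun 'I_k -> 'I_n} :=
  [ffun j => Ordinal (shift_lt le j)].

Lemma shift_map_increasing n k t (le : (k + t <= n)%N) : increasing (shift_map le).
Proof. by apply/increasingP=> i j ltij; rewrite !ffunE /= ltn_add2l. Qed.

Lemma minor_sum_neq0 n k :
  (k <= n)%N -> exists X : 'M[F]_(n, k), minor_sum X != 0.
Proof.
move=> lekn; have le0 : (k + 0 <= n)%N by rewrite addn0.
exists (\matrix_(i, j) (i == shift_map le0 j)%:R).
by rewrite minor_sum_unit ?oner_neq0 ?shift_map_increasing.
Qed.

(** Complete [u] by the column [eb - ea] and by unit columns for the other rows of a window of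
    [k.+2] consecutive rows. Subtracting [(u a 0 + u b 0) *: ea] from [u] makes rows [a] and [b]
    opposite, so only that multiple of [ea] contributes, with minor sum 1. *)
Lemma minor_sum_radical n k (u : 'cV[F]_n) (a b : 'I_n) :
  (k.+2 <= n)%N -> b = a.+1 :> nat ->
  (forall Y : 'M_(n, k.+1), minor_sum (row_mx u Y : 'M_(n, 1 + k.+1)) = 0) ->
  u a 0 + u b 0 = 0.
Proof.
move=> lekn ab rad; have walt := minor_sum_alternating F n (1 + k.+1).
have neqab : a != b by apply/eqP=> eqab; move: ab; rewrite eqab; lia.
(* The window starts at [a], or earlier if it would otherwise run past row [n]; it always contains
   [a] and [b]. *)
pose t := minn a (n - k.+2).
have let_ : (k.+2 + t <= n)%N by rewrite /t; lia.
have ltp1 : ((a - t).+1 < k.+2)%N by have := ltn_ord b; rewrite ab /t; lia.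
have ltp : (a - t < k.+2)%N by apply: ltnW.
have leta : (t <= a)%N by rewrite geq_minl.
pose f := shift_map let_.
pose p : 'I_k.+2 := Ordinal ltp; pose p1 : 'I_k.+2 := Ordinal ltp1.
have neqp : p1 != p by rewrite -val_eqE /=; lia.
have fp : f p = a by apply: val_inj; rewrite ffunE /=; lia.
have fp1 : f p1 = b by apply: val_inj; rewrite ffunE /=; lia.
have finj := increasing_inj (shift_map_increasing let_).
pose M (y z : 'cV[F]_n) : 'M[F]_(n, 1 + k.+1) :=
  \matrix_(i, j) if j == p then y i 0 else if j == p1 then z i 0 else (i == f j)%:R.
pose ea : 'cV[F]_n := delta_mx a 0; pose eb : 'cV[F]_n := delta_mx b 0.
have nzd (j : 'I_(1 + k.+1)) : delta_mx j 0 != 0 :> 'cV[F]_(1 + k.+1).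
  by apply/eqP=> /colP/(_ j)/eqP; rewrite !mxE !eqxx oner_eq0.
have Mu : minor_sum (M u (eb - ea)) = 0.
  apply: (altform_radical walt (nzd p)) => Y.
  have -> : M u (eb - ea) *m delta_mx p 0 = u.
    by apply/colP=> i; rewrite -colE !mxE eqxx.
  exact: rad.
have M1 : minor_sum (M ea (eb - ea)) = 1.
  rewrite (proj2 walt p1 (-1) _ (M ea ea) (M ea eb)).
  - have -> : minor_sum (M ea ea) = 0.
      apply: (altform_dep walt (_ : delta_mx p 0 - delta_mx p1 0 != 0)).
        apply/eqP=> /colP/(_ p)/eqP.
        by rewrite !mxE !eqxx [p == p1]eq_sym (negPf neqp) subr0 oner_eq0.
      by apply/colP=> i; rewrite mulmxBr -!colE !mxE !eqxx (negPf neqp) subrr.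
    rewrite mulr0 add0r -(minor_sum_unit F (shift_map_increasing let_)).
    congr minor_sum; apply/matrixP=> i j; rewrite !mxE andbT.
    case: (j =P p) => [->|_]; first by rewrite fp.
    by case: (j =P p1) => [->|_//]; rewrite andbT fp1.
  - by move=> i l neql; rewrite !mxE (negPf neql).
  - by move=> i; rewrite !mxE (negPf neqp) eqxx ?mxE mulN1r addrC.
pose lam := u a 0 + u b 0; pose u' := u - lam *: ea.
have M0 : minor_sum (M u' (eb - ea)) = 0.
  pose N : 'M[F]_(n, 1 + k.+1) :=
    \matrix_(i, j) if (i == a) || (i == b) then 0 else M u' (eb - ea) i j.
  rewrite (@minor_sum_opp_rows _ _ _ _ N a b ab).
  - apply: (altform_dep walt (nzd p1)); apply/colP=> i; rewrite -colE !mxE.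
    case: ifP => // /norP[neqa neqb]; rewrite (negPf neqp) eqxx ?mxE.
    by rewrite (negPf neqa) (negPf neqb) subrr.
  - move=> j; rewrite !mxE; case: (j =P p) => [_|neqj].
      by rewrite ?mxE !eqxx [b == a]eq_sym (negPf neqab) /lam /=; ring.
    case: (j =P p1) => [_|neqj1].
      by rewrite ?mxE !eqxx [b == a]eq_sym (negPf neqab) /=; ring.
    rewrite -fp -fp1 !(inj_eq finj) ![_ == j]eq_sym.
    by move/eqP/negPf: neqj => ->; move/eqP/negPf: neqj1 => ->; rewrite oppr0.
  - by move=> j; rewrite !mxE !eqxx orbT.
  - by move=> i j /negPf neqa /negPf neqb; rewrite mxE neqa neqb.
move: Mu; rewrite (proj2 walt p lam _ (M ea (eb - ea)) (M u' (eb - ea))).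
- by rewrite M1 M0 mulr1 addr0.
- by move=> i l neql; rewrite !mxE (negPf neql).
- by move=> i; rewrite !mxE eqxx ?mxE; ring.
Qed.

(** Consecutive entries of a radical vector are opposite, so it is a multiple of the alternating
    sign vector. *)
Lemma dim_minor_sum_radical n k (U : {vspace 'cV[F]_n}) :
  (k.+2 <= n)%N ->
  (forall u, u \in U ->
     forall Y : 'M_(n, k.+1), minor_sum (row_mx u Y : 'M_(n, 1 + k.+1)) = 0) ->
  (\dim U <= 1)%N.
Proof.
move=> lekn rad; have n0 : (0 < n)%N by apply: leq_trans lekn.
pose x : 'cV[F]_n := \col_i (-1) ^+ i.
have sUx : (U <= <[x]>)%VS.
  apply/subvP=> u uU; apply/vlineP; exists (u (Ordinal n0) 0).
  apply/colP=> -[i ltin]; rewrite !mxE /=.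
  elim: i ltin => [|i IHi] ltin.
    by rewrite expr0 mulr1; congr (u _ _); apply: val_inj.
  have lti : (i < n)%N by apply: ltnW.
  have /eqP := @minor_sum_radical _ _ u (Ordinal lti) (Ordinal ltin) lekn erefl (rad u uU).
  by rewrite addrC addr_eq0 => /eqP ->; rewrite IHi exprS; ring.
by apply: leq_trans (dimvS sUx) _; rewrite dim_vline leq_b1.
Qed.

(** Were the codimension at least 2, the projection to the other columns would have codimension
    below [k], so the whole column space would be radical by [altform_codim]. Its dimension is at
    least [n - (1 + k) >= 2], but the radical is at most a line when [k > 0]; for [k = 0] this count
    is already the claim. *)
Lemma minor_sum_column_space n k (s : 'M[F]_(n, 1 + k)) (V : {vspace 'M[F]_(n, 1 + k)}) :
  (1 + k + 2 <= n)%N -> (\dim V + (1 + k) = n * (1 + k))%N ->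
  (forall X, X - s \in V -> minor_sum X = 0) ->
  forall v : 'rV_(1 + k), v != 0 -> (n <= \dim (column_space v V) + 1)%N.
Proof.
move=> lekn dimV w0 v nzv; have walt := minor_sum_alternating F n (1 + k).
have base (s1 : 'M[F]_(n, 1 + k)) (W : {vspace 'M[F]_(n, 1 + k)}) :
    (\dim W + (1 + k) = n * (1 + k))%N ->
    (forall X, X - s1 \in W -> minor_sum X = 0) ->
    (n <= \dim (column_space e0 W) + 1)%N.
  move=> {}dimV {}w0; apply: contraT; rewrite -ltnNge => small; exfalso.
  have := dim_column_space W; have := leq_dim_matrix (linfun rsubmx @: W)%VS.
  move: dimV; move: (\dim W) => d dimV dimI dimd.
  have rad u : u \in column_space e0 W -> forall Y : 'M_(n, k), minor_sum (row_mx u Y) = 0.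
    move=> uU Y; apply/eqP; apply: contraT => nz; exfalso.
    have := @altform_codim _ _ _ _ (rsubmx s1) (linfun rsubmx @: W)%VS Y
      (altform_contract u walt) nz.
    move/(_ (fun Y' => @altform_contract_vanish _ _ _ _ _ _ _ Y' walt w0 uU)).
    move: small dimI dimd; move: (\dim _) (\dim _) => d1 d2.
    by move: dimV; rewrite mulnDr muln1; move: (n * k)%N; lia.
  have lt1 : (n <= \dim (column_space e0 W) + (1 + k))%N.
    move: dimI dimd; move: (\dim _) (\dim _) => d1 d2.
    by move: dimV; rewrite mulnDr muln1; move: (n * k)%N; lia.
  case: k lekn s V W s1 dimV v walt w0 nzv dimI dimd small rad lt1
    => [|k] lekn s V W s1 _ v _ _ _ _ _ small rad lt1.
    by move: small lt1; move: (\dim _); lia.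
  have : (\dim (column_space e0 W) <= 1)%N.
    by apply: (@dim_minor_sum_radical _ k) => //; move: lekn; lia.
  by move: small lt1 lekn; move: (\dim _); lia.
have [P Pu vP] := row_to_delta nzv.
have Qu : invmx P \in unitmx by rewrite unitmx_inv.
have [W dimW WE] := mulmx_preim V Qu.
have -> : column_space v V = column_space e0 W.
  apply/vspaceP=> u; rewrite !column_spaceE WE -vP.
  by rewrite mulmxA mulmxK.
apply: (base (s *m P)) => [|X]; first by rewrite dimW.
rewrite WE mulmxBl mulmxK // => /w0; rewrite (proj1 walt) => /eqP.
rewrite mulf_eq0 => /orP[/eqP//|]; move: Qu; rewrite unitmxE unitfE => nz.
by rewrite (negPf nz).
Qed.

End Vanishing.

(** * Functionals dividing the sum of minors *)

Section Divisors.
Variable F : fieldType.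

(** An invertible column change carries any nonzero row [phi *m X] to [sigma], so [w] vanishes
    wherever that row is nonzero. Linearity in the first column then reaches the remaining
    matrices. *)
Lemma altform_level_set n k (w : 'M[F]_(n, 1 + k) -> F) (phi : 'rV[F]_n)
    (sigma : 'rV[F]_(1 + k)) :
  alternating_form w -> phi != 0 -> sigma != 0 ->
  (forall X, phi *m X = sigma -> w X = 0) -> forall X, w X = 0.
Proof.
move=> walt nzphi nzsigma w0.
have w1 X : phi *m X != 0 -> w X = 0.
  move=> nzX; have [P Pu XP] := row_to_delta nzX.
  have [Q Qu sQ] := row_to_delta nzsigma.
  have /w0 : phi *m (X *m (P *m invmx Q)) = sigma by rewrite !mulmxA XP -sQ mulmxK.
  rewrite (proj1 walt) => /eqP; rewrite mulf_eq0 => /orP[/eqP//|].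
  have : P *m invmx Q \in unitmx by rewrite unitmx_mul Pu unitmx_inv.
  by rewrite unitmxE unitfE => /negPf ->.
move=> X; have [X0 | /w1//] := eqVneq (phi *m X) 0.
have [i nzi] : exists i, phi 0 i != 0.
  by apply/existsP; apply: contraNT nzphi => /existsPn z; apply/eqP/rowP=> i; rewrite mxE;
    apply/eqP; have := z i; rewrite negbK.
pose u : 'cV[F]_n := delta_mx i 0.
have nzu (Y : 'M_(n, k)) (x : 'cV_n) : phi *m x = 0 -> phi *m row_mx (u + x) Y != 0.
  move=> x0; rewrite mul_mx_row mulmxDr x0 addr0; apply/eqP=> /rowP/(_ (lshift k 0))/eqP.
  by rewrite row_mxEl -colE !mxE (negPf nzi).
pose x := lsubmx X; pose Y := rsubmx X.
have x0 : phi *m x = 0.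
  by move: X0; rewrite -[X]hsubmxK mul_mx_row -row_mx0 => /eq_row_mx[].
have wu : w (row_mx u Y) = 0 by rewrite -[u]addr0; apply/w1/nzu; rewrite mulmx0.
have := w1 _ (nzu Y x x0).
rewrite (proj2 walt (lshift k 0) 1 _ (row_mx u Y) (row_mx x Y)).
- by rewrite wu mulr0 add0r hsubmxK.
- move=> j l; case: (split_ordP l) => m ->; last by rewrite !row_mxEr.
  by rewrite ord1 eqxx.
- by move=> j; rewrite !row_mxEl !mxE mul1r.
Qed.

(** If the two entries differ, unit columns in rows other than [a] and [b] can be corrected by
    multiples of [ea - eb] so that [phi] kills them. Rows [a] and [b] are then opposite and the
    minor sum stays 1. *)
Lemma minor_sum_divisor_const n k (phi : 'rV[F]_n) (a b : 'I_n) :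
  (k + 2 <= n)%N -> b = a.+1 :> nat ->
  (forall X : 'M_(n, k), phi *m X = 0 -> minor_sum X = 0) -> phi 0 a = phi 0 b.
Proof.
move=> lekn ab w0; apply/eqP; rewrite -subr_eq0; apply: contraT => nzd; exfalso.
have ltf (j : 'I_k) : ((if j < a then j : nat else j.+2) < n)%N.
  by have := ltn_ord j; case: ifP; lia.
pose f : {ffun 'I_k -> 'I_n} := [ffun j => Ordinal (ltf j)].
have fP : increasing f.
  by apply/increasingP=> i j ltij; rewrite !ffunE /=; case: ifP; case: ifP; lia.
have neqab : a != b by apply/eqP=> eqab; move: ab; rewrite eqab; lia.
have fa j : (a == f j) = false.
  by apply/negP=> /eqP/(congr1 val); rewrite ffunE /=; case: ifP; lia.
have fb j : (b == f j) = false.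
  by apply/negP=> /eqP/(congr1 val); rewrite ffunE /= ab; case: ifP; lia.
pose c j := - phi 0 (f j) / (phi 0 a - phi 0 b).
pose X : 'M[F]_(n, k) :=
  \matrix_(i, j) ((i == f j)%:R + (i == a)%:R * c j - (i == b)%:R * c j).
have pick (i0 : 'I_n) : \sum_i phi 0 i * (i == i0)%:R = phi 0 i0.
  rewrite (bigD1 i0) //= eqxx mulr1 big1 ?addr0 // => i /negPf ->.
  by rewrite mulr0.
have X0 : phi *m X = 0.
  apply/rowP=> j; rewrite !mxE.
  transitivity (phi 0 (f j) + phi 0 a * c j - phi 0 b * c j).
    rewrite -(pick (f j)) -(pick a) -(pick b) !mulr_suml -sumrN -!big_split /=.
    by apply: eq_bigr => i _; rewrite mxE; ring.
  by rewrite /c; field.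
have := minor_sum_unit F fP.
rewrite -(@minor_sum_opp_rows _ _ _ X _ a b ab) ?w0 //.
- by move/eqP; rewrite eq_sym oner_eq0.
- by move=> j; rewrite !mxE !eqxx [b == a]eq_sym (negPf neqab) fa fb /=; ring.
- by move=> j; rewrite !mxE fa fb.
- by move=> i j /negPf na /negPf nb; rewrite !mxE na nb /=; ring.
Qed.

(** For even [k], take [k.+1] unit columns and subtract the first from the others: the minor sum
    stays 1 and only the first column sum is nonzero. In [minor_sum_wedge], the one surviving term
    contains the minor sum of the other columns, which is zero by hypothesis. *)
Lemma minor_sum_divisor_odd n k :
  (k.+1 <= n)%N ->
  (forall X : 'M[F]_(n, k), const_mx 1 *m X = 0 :> 'rV_k -> minor_sum X = 0) -> odd k.
Proof.
move=> lekn w0; apply: contraT => evenk; exfalso.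
have le0 : (k.+1 + 0 <= n)%N by rewrite addn0.
pose f := shift_map le0.
have fP : increasing f by apply: shift_map_increasing.
pose E : 'M[F]_(n, 1 + k) := \matrix_(i, j) (i == f j)%:R.
pose P : 'M[F]_(1 + k) := block_mx 1%:M (- const_mx 1) 0 1%:M.
have detP : \det P = 1 by rewrite det_ublock !det1 mulr1.
have sumE : const_mx 1 *m E = const_mx 1 :> 'rV_(1 + k).
  apply/rowP=> j; rewrite !mxE (bigD1 (f j)) //= !mxE eqxx mulr1 big1 ?addr0 //.
  by move=> i /negPf neqi; rewrite !mxE neqi mulr0.
have sumZ : const_mx 1 *m (E *m P) = row_mx 1%:M 0 :> 'rV_(1 + k).
  rewrite mulmxA sumE -(row_mx_const 1 1 k) mul_row_block mulmx1 mulmx0 addr0 mulmx1.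
  congr row_mx; first by apply/rowP=> j; rewrite !mxE !ord1.
  by apply/rowP=> j; rewrite !mxE big_ord1 !mxE mul1r addNr.
have : minor_sum (E *m P) = 1.
  by rewrite (proj1 (minor_sum_alternating F n (1 + k))) detP mulr1 minor_sum_unit.
rewrite (minor_sum_wedge _ evenk).
have colsum j : \sum_i (E *m P) i j = (row_mx 1%:M 0 : 'rV_(1 + k)) 0 j.
  by rewrite -sumZ mxE; apply: eq_bigr => i _; rewrite [const_mx _ _ _]mxE mul1r.
rewrite big1 => [/eqP|j _]; first by rewrite eq_sym oner_eq0.
rewrite colsum; case: (@split_ordP 1 k j) => l eql; rewrite eql; last first.
  by rewrite row_mxEr mxE mulr0 mul0r.
rewrite w0 ?mulr0 //; apply/rowP=> m.
rewrite [RHS]mxE mxE (eq_bigr (fun i => (E *m P) i (rshift 1 m))) => [|i _].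
  by rewrite colsum row_mxEr mxE.
rewrite [const_mx _ _ _]mxE mul1r mxE; congr (_ _ _); apply: val_inj.
by rewrite /= ord1.
Qed.

Theorem minor_sum_variety n k (s : 'M[F]_(n, k)) (V : {vspace 'M[F]_(n, k)}) :
  (0 < k)%N -> (k + 2 <= n)%N ->
  (forall X, X - s \in V -> minor_sum X = 0) -> (\dim V + k = n * k)%N ->
  odd k /\ forall X, (X - s \in V) = (const_mx 1 *m X == 0 :> 'rV_k).
Proof.
case: k s V => // k s V _ lekn w0 dimV; have walt := minor_sum_alternating F n (1 + k).
have := minor_sum_column_space lekn dimV w0.
move/(rank_one_hyperplane (ltn0Sn k) dimV) => [phi nzphi phiV].
have [X1 nzX1] : exists X : 'M[F]_(n, 1 + k), minor_sum X != 0.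
  by apply: minor_sum_neq0; move: lekn; lia.
(* Otherwise [s + V] contains the whole level set of [phi] through [X], and the sum of minors would
   vanish identically. *)
have phi0 X : X - s \in V -> phi *m X = 0.
  move=> XV; apply/eqP; apply: contraT => nz; exfalso; case/eqP: nzX1.
  apply: (altform_level_set walt nzphi nz) => Y eqY; apply: w0.
  rewrite -(subrK X Y) -addrA; apply: rpredD => //; apply: phiV.
  by rewrite mulmxBr eqY subrr.
have phis : phi *m s = 0 by apply: phi0; rewrite subrr mem0v.
have wphi (X : 'M_(n, k.+1)) : phi *m X = 0 -> minor_sum X = 0.
  by move=> X0; apply: w0; apply: phiV; rewrite mulmxBr X0 phis subrr.
have n0 : (0 < n)%N by move: lekn; lia.
pose c := phi 0 (Ordinal n0).
have phiE : phi = c *: const_mx 1.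
  apply/rowP=> -[i ltin]; rewrite !mxE mulr1.
  elim: i ltin => [|i IHi] ltin; first by congr (phi _ _); apply: val_inj.
  have lti : (i < n)%N by apply: ltnW.
  by rewrite -(IHi lti); symmetry; apply: (minor_sum_divisor_const lekn _ wphi).
have nzc : c != 0 by apply: contraNneq nzphi => c0; rewrite phiE c0 scale0r.
have phiX (X : 'M_(n, k.+1)) : (phi *m X == 0) = (const_mx 1 *m X == 0 :> 'rV_k.+1).
  by rewrite phiE -scalemxAl scaler_eq0 (negPf nzc).
split.
  apply: (@minor_sum_divisor_odd n) => [|X X0]; first by move: lekn; lia.
  by apply: wphi; apply/eqP; rewrite phiX X0.
move=> X; rewrite -phiX; apply/idP/eqP => [/phi0//|X0].
by apply: phiV; rewrite mulmxBr X0 phis subrr.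
Qed.

Lemma minor_sum_odd n k (X : 'M[F]_(n, k)) :
  odd k -> const_mx 1 *m X = 0 :> 'rV_k -> minor_sum X = 0.
Proof.
case: k X => // k X evenk X0; rewrite (minor_sum_wedge _ evenk) big1 // => j _.
have -> : \sum_i X i j = (const_mx 1 *m X : 'rV_k.+1) 0 j.
  by rewrite mxE; apply: eq_bigr => i _; rewrite [const_mx _ _ _]mxE mul1r.
by rewrite X0 mxE mulr0 mul0r.
Qed.

Lemma dim_column_sum_zero n k (V : {vspace 'M[F]_(n, k)}) :
  (0 < n)%N -> (forall X, (X \in V) = (const_mx 1 *m X == 0 :> 'rV_k)) ->
  (\dim V + k = n * k)%N.
Proof.
move=> n0 VE; pose f : 'Hom('M[F]_(n, k), 'rV[F]_k) := linfun (mulmx (const_mx 1)).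
have kerf : lker f = V by apply/vspaceP=> X; rewrite memv_ker lfunE VE.
have imf : limg f = fullv.
  apply/vspaceP=> y; rewrite memvf; apply/memv_imgP.
  exists (delta_mx (Ordinal n0) 0 *m y); rewrite ?memvf // lfunE /= mulmxA -colE.
  rewrite (_ : col _ _ = 1%:M) ?mul1mx //.
  by apply/rowP=> j; rewrite !mxE !ord1.
have := limg_ker_dim f fullv; rewrite capfv kerf imf !dimvf => eqd.
have : (\dim V + 1 * k = n * k)%N by exact: eqd.
by rewrite mul1n.
Qed.

(** * The sign change relating Cullis' determinant to the sum of minors *)

Definition sign_rows n k (X : 'M[F]_(n, k)) : 'M[F]_(n, k) :=
  diag_mx (\row_i (-1) ^+ i) *m X.

Lemma sign_rowsE n k (X : 'M[F]_(n, k)) i j : sign_rows X i j = (-1) ^+ i * X i j.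
Proof. by rewrite /sign_rows mul_diag_mx !mxE. Qed.

Lemma sign_rowsK n k : involutive (@sign_rows n k).
Proof. by move=> X; apply/matrixP=> i j; rewrite !sign_rowsE signrMK. Qed.

(** The sign of a row set splits into the signs of its rows and a global sign; the truncated
    subtraction is exact because [a <= f a]. *)
Lemma cullis_det_minor_sum n k (X : 'M[F]_(n, k)) :
  cullis_det X = (-1) ^+ (\sum_(a < k) a)%N * minor_sum (sign_rows X).
Proof.
rewrite /cullis_det /minor_sum mulr_sumr; apply: eq_bigr => f fP.
have -> : rowsub f (sign_rows X) =
    diag_mx (\row_a (-1) ^+ f a) *m (\matrix_(i, j) X (f i) j).
  by apply/matrixP=> i j; rewrite mul_diag_mx mxE sign_rowsE !mxE.
rewrite det_mulmx det_diag mulrA; congr (_ * _).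
rewrite -!prodrXr -big_split /=; apply: eq_bigr => a _.
have := increasing_ge a fP; rewrite mxE => lea.
by rewrite -signr_odd oddB // addbC -oddD signr_odd exprD.
Qed.

Lemma alt_row_sum_sign_rows n k (X : 'M[F]_(n, k)) :
  alt_row_sum X = - (const_mx 1 *m sign_rows X).
Proof.
apply/rowP=> j; rewrite /alt_row_sum summxE [RHS]mxE [in RHS]mxE -sumrN.
apply: eq_bigr => i _.
by rewrite sign_rowsE !mxE mul1r exprS mulN1r mulNr.
Qed.

End Divisors.

Theorem mainTheorem1 (F : fieldType) (n k : nat) (s : 'M[F]_(n, k))
  (V : {vspace 'M[F]_(n, k)}) :
  (0 < k)%N -> (k + 2 <= n)%N ->
  ((forall X : 'M[F]_(n, k), X \in linvar s V -> cullis_det X = 0)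
     /\ linvar_codim V = k)
  <->
  (odd k /\ forall X : 'M[F]_(n, k), (X \in linvar s V) = (alt_row_sum X == 0)).
Proof.
move=> k0 lekn; have n0 : (0 < n)%N by move: lekn; lia.
pose f : 'End('M[F]_(n, k)) := linfun (mulmx (diag_mx (\row_i (-1) ^+ i))).
have fE X : f X = sign_rows X by rewrite lfunE.
pose W := (f @^-1: V)%VS.
have WE X : (X \in W) = (sign_rows X \in V) by rewrite -memv_preim fE.
have kerf : (W :&: lker f = 0)%VS.
  apply: vspace_eq0; apply/subvP=> X /memv_capP[_]; rewrite memv_ker fE => /eqP X0.
  by rewrite -(sign_rowsK X) X0 /sign_rows mulmx0 mem0v.
have dimW : \dim W = \dim V.
  rewrite -(limg_dim_eq kerf) lpreimK //; apply/subvP=> X _; apply/memv_imgP.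
  by exists (sign_rows X); rewrite ?memvf // fE sign_rowsK.
have linvarE X : (sign_rows X \in linvar s V) = (X - sign_rows s \in W).
  by rewrite inE WE /sign_rows mulmxBr -!/(sign_rows _) sign_rowsK.
have altE X : (alt_row_sum (sign_rows X) == 0) = (const_mx 1 *m X == 0 :> 'rV_k).
  by rewrite alt_row_sum_sign_rows sign_rowsK oppr_eq0.
have cullisE X : (cullis_det (sign_rows X) == 0) = (minor_sum X == 0).
  by rewrite cullis_det_minor_sum sign_rowsK mulf_eq0 signr_eq0.
have codimE : linvar_codim V = k <-> (\dim W + k = n * k)%N.
  rewrite /linvar_codim dimW; have := leq_dim_matrix V.
  by move: (\dim V) => d led; split; move: led k0; move: (n * k)%N; lia.
split=> [[w0 /codimE dimV] | [oddk VE]].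
  have wW X : X - sign_rows s \in W -> minor_sum X = 0.
    by move=> XW; apply/eqP; rewrite -cullisE w0 // linvarE.
  have [oddk WV] := minor_sum_variety k0 lekn wW dimV.
  split=> // X; rewrite -[X]sign_rowsK linvarE altE; exact: WV.
have WV X : (X - sign_rows s \in W) = (const_mx 1 *m X == 0 :> 'rV_k).
  by rewrite -linvarE VE altE.
split=> [X | ].
  rewrite -[X]sign_rowsK linvarE WV => /eqP/(minor_sum_odd oddk)/eqP.
  by rewrite -cullisE => /eqP.
apply/codimE/dim_column_sum_zero => // X.
(* The base point lies in its own variety, so its signed column sums vanish and [W] itself is the
   kernel of the column-sum map. *)
have := WV (sign_rows s); rewrite subrr mem0v => /esym/eqP s0.
by have := WV (X + sign_rows s); rewrite addrK mulmxDr s0 addr0.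
Qed.
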